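(* Let $v,w\ge 2$ be integers. An $LSSD(v,k,\lambda;w)$ is equivalent to a set of $w$ linked simplices in $\mathbb{R}^{v-1}$, in the following sense. (a) For every $LSSD(v,k,\lambda;w)$ $\Gamma$ with fibers $X_1,\dots,X_w$ there are a set of $w$ linked simplices in $\mathbb{R}^{v-1}$ with inner products $\gamma\ne\zeta$ and a bijective labelling of the vectors of the $i$-th simplex by the vertices in $X_i$ ($1\le i\le w$), such that two vectors labelled by vertices $x,y$ in distinct fibers have inner product $\gamma$ if $x\sim y$ in $\Gamma$ and $\zeta$ if $x\not\sim y$. (b) Conversely, given a set of $w$ linked simplices in $\mathbb{R}^{v-1}$ with inner products $\gamma>\zeta$, the graph whose fibers are the $w$ (indexed) simplices and in which vertices of two different simplices are adjacent if and only if their inner product is $\gamma$ is an $LSSD(v,k,\lambda;w)$ for some $k,\lambda$.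
   Context: A symmetric $(v,k,\lambda)$-design, $0<k<v$, consists of a set of $v$ points and a collection of $v$ blocks such that every block contains $k$ points, every point lies in $k$ blocks, every pair of distinct points lies in exactly $\lambda$ common blocks, and every pair of distinct blocks meets in exactly $\lambda$ points. Its incidence graph is the bipartite graph on points and blocks with a point adjacent to a block iff the point is in the block. A linked system of symmetric designs $LSSD(v,k,\lambda;w)$, $w\ge 2$, is a graph $\Gamma$ on $wv$ vertices whose vertex set is partitioned into $w$ sets (''fibers'') $X_1,\dots,X_w$ of size $v$ such that: (i) no edge has both ends in the same fiber; (ii) for all $i\ne j$, the subgraph of $\Gamma$ induced between $X_i$ and $X_j$ is the incidence graph of some symmetric $(v,k,\lambda)$-design; (iii) there are constants $\mu,\nu$ such that for all distinct $h,i,j$ and all $a\in X_i$, $b\in X_j$, the number of common neighbours of $a$ and $b$ lying in $X_h$ is $\mu$ if $a\sim b$ and $\nu$ if $a\not\sim b$. A regular simplex in $\mathbb{R}^{v-1}$ is a family of $v$ unit vectors spanning $\mathbb{R}^{v-1}$ such that any two distinct ones have inner product $\frac{-1}{v-1}$. A set of $w$ linked simplices with inner products $\gamma,\zeta$ is an indexed family of $w$ regular simplices in $\mathbb{R}^{v-1}$ such that $\langle a,b\rangle\in\{\gamma,\zeta\}$ whenever $a$ and $b$ are vertices of simplices with different indices (vectors of different simplices are regarded as different vertices). *)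

(* Defs.v *)
From HB Require Import structures.
From mathcomp Require Import all_boot all_order all_algebra.
From mathcomp Require Import reals.

Set Implicit Arguments.
Unset Strict Implicit.
Unset Printing Implicit Defensive.

Import Order.TTheory GRing.Theory Num.Theory.

Local Open Scope ring_scope.

(* Blocks are indexed by a type and are not assumed to be distinct as sets of
   points. *)
Record symmetric_design (v k lam : nat) := SymmetricDesign {
  sd_point : finType;
  sd_block : finType;
  sd_inc : sd_point -> sd_block -> bool;
  sd_k_gt0 : (0 < k)%N;
  sd_k_ltv : (k < v)%N;
  sd_card_point : #|sd_point| = v;
  sd_card_block : #|sd_block| = v;
  sd_block_size : forall b, #|[set p | sd_inc p b]| = k;
  sd_point_degree : forall p, #|[set b | sd_inc p b]| = k;
  sd_point_pair : forall p q, p != q ->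
    #|[set b | sd_inc p b && sd_inc q b]| = lam;
  sd_block_pair : forall b c, b != c ->
    #|[set p | sd_inc p b && sd_inc p c]| = lam
}.

Definition incidence_graph (v k lam : nat) (D : symmetric_design v k lam) :
    rel (sd_point D + sd_block D) :=
  fun s t => match s, t with
             | inl p, inr b => sd_inc p b
             | inr b, inl p => sd_inc p b
             | _, _ => false
             end.

Definition edges_between (V : finType) (e : rel V) (X Y : {set V}) : rel V :=
  fun x y => e x y && ((x \in X) && (y \in Y) || (x \in Y) && (y \in X)).

(* "Is the incidence graph of D" is understood up to a graph isomorphism that
   sends points onto X and blocks onto Y. *)
Definition is_incidence_graph_between (v k lam : nat)
    (D : symmetric_design v k lam) (V : finType) (e : rel V) (X Y : {set V}) :
    Prop :=
  exists phi : sd_point D + sd_block D -> V,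
    [/\ injective phi,
        [set phi (inl p) | p : sd_point D] = X,
        [set phi (inr b) | b : sd_block D] = Y &
        forall s t, edges_between e X Y (phi s) (phi t) = incidence_graph s t].

Record is_LSSD (v k lam w : nat) (V : finType) (e : rel V)
    (X : 'I_w -> {set V}) : Prop := IsLSSD {
  lssd_w_ge2 : (2 <= w)%N;
  lssd_sym : symmetric e;
  lssd_irr : irreflexive e;
  lssd_order : #|V| = (w * v)%N;
  lssd_cover : \bigcup_i X i = [set: V];
  lssd_disjoint : forall i j, i != j -> [disjoint X i & X j];
  lssd_fiber_size : forall i, #|X i| = v;
  lssd_fiber_coclique : forall i x y, x \in X i -> y \in X i -> ~~ e x y;
  lssd_design : forall i j, i != j ->
    exists D : symmetric_design v k lam,
      is_incidence_graph_between D e (X i) (X j);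
  lssd_linked : exists mu nu : nat,
    forall h i j, h != i -> h != j -> i != j ->
    forall a b, a \in X i -> b \in X j ->
      #|[set c in X h | e a c && e b c]| = if e a b then mu else nu
}.

Definition dotprod (R : realType) (n : nat) (u u' : 'rV[R]_n) : R :=
  \sum_i u 0 i * u' 0 i.

Record regular_simplex (R : realType) (v : nat)
    (S : 'I_v -> 'rV[R]_(v.-1)) : Prop := RegularSimplex {
  rs_unit : forall a, dotprod (S a) (S a) = 1;
  rs_span : (<<[seq S a | a : 'I_v]>> = fullv)%VS;
  rs_dot : forall a b, a != b -> dotprod (S a) (S b) = -1 / (v.-1)%:R
}.

Definition linked_simplices (R : realType) (v w : nat) (gamma zeta : R)
    (S : 'I_w -> 'I_v -> 'rV[R]_(v.-1)) : Prop :=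
  (forall i, regular_simplex (S i)) /\
  (forall i j a b, i != j ->
     dotprod (S i a) (S j b) = gamma \/ dotprod (S i a) (S j b) = zeta).

(* A vertex is a pair (index of the simplex, index of the vector in it), so
   equal vectors in different simplices give different vertices. *)
Definition simplex_graph (R : realType) (v w : nat) (gamma : R)
    (S : 'I_w -> 'I_v -> 'rV[R]_(v.-1)) : rel ('I_w * 'I_v) :=
  fun x y => (x.1 != y.1) && (dotprod (S x.1 x.2) (S y.1 y.2) == gamma).

Definition simplex_fiber (v w : nat) (i : 'I_w) : {set 'I_w * 'I_v} :=
  [set x | x.1 == i].

(* Main.v *)
Require Import Defs.
From mathcomp Require Import all_boot all_order all_algebra.
From mathcomp Require Import reals ring.

Set Implicit Arguments.
Unset Strict Implicit.
Unset Printing Implicit Defensive.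

Import Order.TTheory GRing.Theory Num.Theory.

Local Open Scope ring_scope.

(** Write [v = n + 1], [q = v / n], [I] for the identity, [J] for the all-ones
    matrix, and let [G = q I - n^-1 J] be the Gram matrix of a regular simplex.
    Everything rests on one identity between the cross-Gram matrices
    [B i j = (<S i a, S j b>)_(a, b)] of a family of simplices:
<<
      B i h * B h j = q * B i j         for all h, i, j.
>>
    It holds because the vectors of a regular simplex form a tight frame: if
    the rows of [M] are these vectors, then [M M^T = G] forces [M^T M = q I]
    ([tight_frame_simplex]) and makes the vectors sum to zero
    ([ones_mulmx_simplex]).

    From simplices to designs.  If the entries of [B i j] are [gamma] and
    [zeta], then [B i j = zeta J + (gamma - zeta) A i j] where [A i j] is the
    adjacency matrix between two fibers.  As the rows of [B i j] sum to zero,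
    the identity says that the number of common neighbours in the fiber [h] of
    two vertices outside it is a fixed affine function of their inner product
    ([card_common]).  That inner product is [1] for equal vertices, [-1 / n]
    for two vertices of one fiber, and [gamma] or [zeta] otherwise; this yields
    [k], [lam], [mu] and [nu] in turn.

    From designs to simplices.  Conversely, put
    [B i j = (c / n) (v A i j - k J)] for [i != j] and [B i i = G].  For a
    suitable constant [c] these matrices satisfy the identity
    ([fiber_gram_mul]), and any family that does is realized by simplices
    ([gram_realization]): take one regular simplex [M] with Gram matrix [G],
    and let the rows of [q^-1 B i o M] be the [i]-th simplex.  For
    [i = j] the identity amounts to [c ^ 2 (k - lam) = 1] by the design
    equations; for three distinct fibers it amounts to [c (mu - nu) = 1], since
    [A i h * A h j = (mu - nu) A i j + nu J].  The two requirements are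
    compatible because [(mu - nu) ^ 2 = k - lam] ([lssd_linked_identities]), so
    that [c] is [(k - lam) ^ (-1/2)] with the sign of [mu - nu]; with only two
    fibers either sign will do. *)

(** * Gram matrices of regular simplices *)

Section AllOnes.
Variables (R : realType) (n : nat).
Implicit Types (A B : 'M[R]_n.+1).

Local Notation J := (const_mx 1 : 'M[R]_n.+1).

Lemma mulmx_ones A a b : (A *m J) a b = \sum_c A a c.
Proof. by rewrite mxE; apply: eq_bigr => c _; rewrite mxE mulr1. Qed.

Lemma mul_ones_ones : J *m J = n.+1%:R *: J.
Proof.
apply/matrixP => a b; rewrite mulmx_ones !mxE mulr1.
under eq_bigr do rewrite mxE.
by rewrite sumr_const card_ord.
Qed.

Lemma ones_trmul A al : A *m J = al *: J -> J *m A^T = al *: J.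
Proof. by move=> AJ; rewrite -[J]trmx_const -trmx_mul AJ linearZ. Qed.

(** For matrices with constant row and column sums, identities between products
    of combinations [a A + b J] reduce to identities between scalars. *)
Lemma mul_affine_ones A B a b c d al be :
    A *m J = al *: J -> J *m B = be *: J ->
  (a *: A + b *: J) *m (c *: B + d *: J) =
  (a * c) *: (A *m B) + (a * d * al + b * c * be + b * d * n.+1%:R) *: J.
Proof.
move=> AJ JB.
rewrite mulmxDl !mulmxDr -!scalemxAl -!scalemxAr AJ JB mul_ones_ones !scalerA.
by rewrite -!addrA -!scalerDl !addrA; congr (_ + _ *: _); ring.
Qed.

(** Compare a diagonal and an off-diagonal entry, hence at least two rows. *)
Lemma scalar_ones_inj (x y z t : R) : (0 < n)%N ->
  x *: 1%:M + y *: J = z *: 1%:M + t *: J -> x = z /\ y = t.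
Proof.
move=> n_gt0 E.
have := congr1 (fun M : 'M_n.+1 => M ord0 ord0) E.
have := congr1 (fun M : 'M_n.+1 => M ord0 ord_max) E.
have ne : (ord0 == ord_max :> 'I_n.+1) = false by case: (n) n_gt0.
rewrite !mxE eqxx ne !mulr0 !mulr1 !add0r => ->.
by move/addIr.
Qed.

Definition simplex_gram : 'M[R]_n.+1 :=
  (n.+1%:R / n%:R) *: 1%:M + (- n%:R^-1) *: J.

Local Notation G := simplex_gram.
Local Notation q := (n.+1%:R / n%:R : R).

Lemma simplex_gramE (n_gt0 : (0 < n)%N) a b :
  G a b = if a == b then 1 else -1 / n%:R.
Proof.
have n_neq0 : n%:R != 0 :> R by rewrite pnatr_eq0 -lt0n.
by rewrite !mxE; case: eqP => _ /=; rewrite -?natr1; field.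
Qed.

Lemma mulmx_simplex_gram p (A : 'M_(p, n.+1)) : A *m J = 0 -> A *m G = q *: A.
Proof. by move=> AJ; rewrite mulmxDr -!scalemxAr mulmx1 AJ scaler0 addr0. Qed.

Lemma simplex_gram_mulmx p (A : 'M_(n.+1, p)) : J *m A = 0 -> G *m A = q *: A.
Proof. by move=> JA; rewrite mulmxDl -!scalemxAl mul1mx JA scaler0 addr0. Qed.

Lemma simplex_gram_ones : (0 < n)%N -> G *m J = 0.
Proof.
move=> n_gt0; rewrite mulmxDl -!scalemxAl mul1mx mul_ones_ones scalerA.
rewrite -scalerDl -[RHS](scale0r J); congr (_ *: _).
by field; rewrite pnatr_eq0 -lt0n.
Qed.

Lemma dotprodE p (S T : 'I_n.+1 -> 'rV[R]_p) a b :
  dotprod (S a) (T b) = (\matrix_x S x *m (\matrix_x T x)^T) a b.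
Proof. by rewrite mxE; apply: eq_bigr => i _; rewrite !mxE. Qed.

Section Gram.
Variable (M : 'M[R]_(n.+1, n)).
Hypotheses (n_gt0 : (0 < n)%N) (MMt : M *m M^T = G).

(** The sum [u] of the rows has squared norm [1 G 1^T = 0]. *)
Lemma ones_mulmx_simplex : J *m M = 0.
Proof.
pose u := const_mx 1 *m M : 'rV[R]_n.
have u2 : u *m u^T = 0.
  rewrite trmx_mul mulmxA -[_ *m M *m M^T]mulmxA MMt trmx_const -mulmxA.
  suff -> : G *m const_mx 1 = 0 :> 'cV_n.+1 by rewrite mulmx0.
  apply/matrixP => a b.
  have /matrixP/(_ a ord0) := simplex_gram_ones n_gt0.
  rewrite mulmx_ones [RHS]mxE => Ga0; rewrite [LHS]mxE [RHS]mxE -[RHS]Ga0.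
  by apply: eq_bigr => c _; rewrite [const_mx _ _ _]mxE mulr1.
have u0 j : u 0 j = 0.
  move/matrixP/(_ 0 0): u2; rewrite mxE [RHS]mxE.
  under eq_bigr do rewrite [u^T _ _]mxE.
  move/eqP; rewrite psumr_eq0 => [|c _]; last by rewrite -expr2 sqr_ge0.
  by move/allP/(_ j (mem_index_enum _)) => /=; rewrite mulf_eq0 orbb => /eqP.
apply/matrixP => a j; rewrite [RHS]mxE -(u0 j) !mxE.
by apply: eq_bigr => c _; rewrite !mxE.
Qed.

(** [G] differs from the invertible matrix [q I] by a matrix of rank one, so
    its rank is at least [n]; a fortiori the rank of [M]. *)
Lemma row_full_simplex : row_full M.
Proof.
have n_neq0 : n%:R != 0 :> R by rewrite pnatr_eq0 -lt0n.
have rkJ : (\rank (- n%:R^-1 *: J) <= 1)%N.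
  have -> : - n%:R^-1 *: J = (const_mx (- n%:R^-1) : 'cV_n.+1) *m const_mx 1.
    by apply/matrixP => a b; rewrite !mxE big_ord1 !mxE.
  exact: leq_trans (mxrankM_maxr _ _) (rank_leq_row _).
have qI : q *: 1%:M = G - (- n%:R^-1) *: J by rewrite addrK.
have := mxrank_add G (- ((- n%:R^-1) *: J)).
rewrite -qI mxrank_scale_nz ?mxrank1; last first.
  by rewrite mulf_neq0 ?invr_neq0 // pnatr_eq0.
rewrite mxrank_opp => le_rk.
have rkG : (n <= \rank G)%N.
  rewrite -ltnS; apply: leq_trans le_rk _.
  by rewrite -[X in (_ <= X)%N]addn1 leq_add2l.
rewrite /row_full eqn_leq rank_leq_col (leq_trans rkG) //.
by rewrite -MMt mxrankM_maxl.
Qed.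

(** [M (M^T M) = G M = q M], and [M] can be cancelled on the left since it has
    full column rank. *)
Lemma tight_frame_simplex : M^T *m M = q%:M.
Proof.
apply: (row_full_inj row_full_simplex).
by rewrite mulmxA MMt simplex_gram_mulmx ?ones_mulmx_simplex // mul_mx_scalar.
Qed.

End Gram.

Lemma regular_simplex_gram (S : 'I_n.+1 -> 'rV[R]_n) : (0 < n)%N ->
  regular_simplex S -> (\matrix_x S x) *m (\matrix_x S x)^T = G.
Proof.
move=> n_gt0 [unitS _ dotS]; apply/matrixP => a b.
rewrite -dotprodE simplex_gramE //.
by case: eqVneq => [<-|/dotS]; [exact: unitS|].
Qed.

(** The Gram matrix alone forces the vectors to span the space. *)
Lemma gram_regular_simplex (S : 'I_n.+1 -> 'rV[R]_n) : (0 < n)%N ->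
  (\matrix_x S x) *m (\matrix_x S x)^T = G -> regular_simplex S.
Proof.
move=> n_gt0 MMt; split=> [a||a b ab].
- by rewrite dotprodE MMt simplex_gramE // eqxx.
- apply/eqP; rewrite eqEsubv subvf /=; apply/subvP => u _.
  have /submxP[c ->] : (u <= \matrix_x S x)%MS.
    exact/submx_full/row_full_simplex.
  rewrite mulmx_sum_row; apply: rpred_sum => a _; apply: rpredZ.
  by rewrite rowK memv_span // map_f // mem_enum.
- by rewrite dotprodE MMt simplex_gramE // (negPf ab).
Qed.

(** A regular simplex in coordinates: [al] times the standard basis, shifted by
    [be] in every coordinate, together with the unit vector along the
    diagonal. *)
Lemma simplex_gram_factor : (0 < n)%N ->
  exists M : 'M[R]_(n.+1, n), M *m M^T = G.
Proof.
move=> n_gt0.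
pose r : R := Num.sqrt n%:R.
have n0 : (0 : R) < n%:R by rewrite ltr0n.
have r_neq0 : r != 0 by rewrite sqrtr_eq0 -ltNge.
have nE : n%:R = r ^+ 2 by rewrite sqr_sqrtr // ltW.
pose t : R := Num.sqrt n.+1%:R.
have tE : t ^+ 2 = 1 + r ^+ 2 by rewrite sqr_sqrtr ?ler0n // -nE -natr1 addrC.
(* [al ^ 2 = 1 + 1 / n] gives the first [n] vectors the right distances, and
   [be] solves [al + n be = - r^-1], the condition that their inner products
   with the last one impose. *)
pose al : R := t / r; pose be : R := (- r^-1 - al) / n%:R.
pose M := \matrix_(a < n.+1, j < n)
  if unlift ord_max a is Some i then al *+ (i == j) + be else r^-1.
exists M; apply/matrixP => a b; rewrite simplex_gramE // mxE.
under eq_bigr do rewrite !mxE.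
have cstsum (x : R) : \sum_(j < n) x = r ^+ 2 * x.
  by rewrite sumr_const card_ord -mulr_natl nE.
have delta (i : 'I_n) (F : 'I_n -> R) : \sum_j (i == j)%:R * F j = F i.
  rewrite (bigD1 i) //= eqxx mul1r big1 ?addr0 // => j /negPf.
  by rewrite eq_sym => ->; rewrite mul0r.
have delta1 (i : 'I_n) : \sum_j (i == j)%:R = 1 :> R.
  by rewrite -[RHS](delta i (fun=> 1)); apply: eq_bigr => j _; rewrite mulr1.
case: (unliftP ord_max a) => [i ->|->]; case: (unliftP ord_max b) => [i' ->|->].
- transitivity (\sum_(j < n) (al ^+ 2 * ((i == j)%:R * (i' == j)%:R)
     + al * be * (i == j)%:R + al * be * (i' == j)%:R + be ^+ 2)).
    by apply: eq_bigr => j _; rewrite -![al *+ _]mulr_natr; ring.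
  rewrite !big_split /= -!mulr_sumr delta !delta1 cstsum.
  rewrite (inj_eq lift_inj) [i' == i]eq_sym /be nE.
  have alE : al ^+ 2 = (1 + r ^+ 2) / r ^+ 2 by rewrite exprMn tE exprVn.
  transitivity (al ^+ 2 * (i == i')%:R + (r ^- 2 - al ^+ 2) / r ^+ 2).
    by field.
  by case: eqP => _; rewrite alE /=; field.
- rewrite eq_sym (negPf (neq_lift _ _)).
  transitivity (\sum_(j < n) (al / r * (i == j)%:R + be / r)).
    by apply: eq_bigr => j _; rewrite -mulr_natr; ring.
  by rewrite big_split /= -!mulr_sumr delta1 cstsum /be nE; field.
- rewrite (negPf (neq_lift _ _)).
  transitivity (\sum_(j < n) (al / r * (i' == j)%:R + be / r)).
    by apply: eq_bigr => j _; rewrite -mulr_natr; ring.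
  by rewrite big_split /= -!mulr_sumr delta1 cstsum /be nE; field.
- by rewrite eqxx cstsum; field.
Qed.

(** With [M0] a simplex of Gram matrix [G] and [M i = q^-1 B i o M0], one gets
    [M i (M j)^T = q^-2 B i o G B o j = q^-1 B i o B o j = B i j], as [B i o]
    annihilates [J] and [G] therefore acts on it as [q]. *)
Lemma gram_realization (I : eqType) (B : I -> I -> 'M[R]_n.+1) (o : I) :
    (0 < n)%N -> (forall i, B i i = G) -> (forall i j, (B i j)^T = B j i) ->
    (forall i j, B i j *m J = 0) ->
    (forall i j, B i o *m B o j = q *: B i j) ->
  exists S : I -> 'I_n.+1 -> 'rV[R]_n,
    (forall i, regular_simplex (S i)) /\
    forall i j a b, dotprod (S i a) (S j b) = B i j a b.
Proof.
move=> n_gt0 BG Btr BJ Bmul.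
have [M0 MM0] := simplex_gram_factor n_gt0.
have q_neq0 : q != 0 by rewrite mulf_neq0 ?invr_eq0 ?pnatr_eq0 -?lt0n.
pose M i := q^-1 *: (B i o *m M0).
have MM i j : M i *m (M j)^T = B i j.
  rewrite linearZ /= -scalemxAl -scalemxAr trmx_mul Btr mulmxA.
  rewrite -[_ *m M0 *m M0^T]mulmxA MM0 mulmx_simplex_gram // -scalemxAl Bmul.
  by rewrite !scalerK.
have rowM i : \matrix_x row x (M i) = M i.
  by apply/matrixP => a j; rewrite !mxE.
exists (fun i a => row a (M i)); split=> [i|i j a b].
  by apply: gram_regular_simplex; rewrite // rowM MM.
by rewrite (dotprodE (fun x => row x (M i)) (fun x => row x (M j))) !rowM MM.
Qed.

End AllOnes.

(** * Neighbour counts in incidence graphs *)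

Section Counting.
Variables (V : finType) (R : realType).

Lemma sum_nat_pred (I : finType) (P : pred I) :
  \sum_i (P i)%:R = #|[set i | P i]|%:R :> R.
Proof.
rewrite -natr_sum -big_mkcond /= -sum1_card; congr _%:R.
by apply: eq_bigl => i; rewrite inE.
Qed.

Lemma card_imset_pred (I : finType) (f : I -> V) (X : {set V}) (P : pred V) :
    injective f -> [set f i | i : I] = X ->
  #|[set x in X | P x]| = #|[set i | P (f i)]|.
Proof.
move=> f_inj <-; rewrite -(card_imset _ f_inj); apply: eq_card => x.
rewrite !inE.
apply/andP/imsetP => [[/imsetP[i _ ->] Pi]|[i]].
  by exists i; rewrite ?inE.
by rewrite inE => Pi ->; split=> //; apply: imset_f.
Qed.

(** Treating [x = x'] together with [x <> x'] makes this the list of entries of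
    the adjacency matrix times its transpose.  Since [e] will be symmetric,
    exchanging [X] and [Y] covers the blocks. *)
Lemma incidence_graph_common (v k lam : nat) (D : symmetric_design v k lam)
    (e : rel V) (X Y : {set V}) x x' :
    is_incidence_graph_between D e X Y -> x \in X -> x' \in X ->
  #|[set y in Y | e x y && e x' y]| = if x == x' then k else lam.
Proof.
move=> [phi [phi_inj <- imY phiE]].
move=> /imsetP[p _ ->] /imsetP[p' _ ->].
have eE p0 b : e (phi (inl p0)) (phi (inr b)) = sd_inc p0 b.
  rewrite -[RHS](phiE (inl p0) (inr b)) /edges_between -imY.
  by rewrite !imset_f //= andbT.
rewrite (card_imset_pred (f := phi \o inr) _ _ imY); last first.
  by move=> b c /phi_inj[].
rewrite (inj_eq phi_inj).
have -> : (inl p == inl p' :> sd_point D + sd_block D) = (p == p') by [].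
case: eqVneq => [<-|pp'].
  rewrite -[RHS](sd_point_degree p); apply: eq_card => b.
  by rewrite !inE /= !eE andbb.
by rewrite -[RHS](sd_point_pair pp'); apply: eq_card => b; rewrite !inE /= !eE.
Qed.

End Counting.

(** * The Gram matrices of a linked system of designs *)

Section FromLSSD.
Variables (R : realType) (n w k lam : nat) (V : finType) (e : rel V).
Variables (X : 'I_w -> {set V}) (l : 'I_w -> 'I_n.+1 -> V).
Hypotheses (n_gt0 : (0 < n)%N) (lssd : is_LSSD n.+1 k lam e X).
Hypotheses (l_inj : forall i, injective (l i)).
Hypothesis l_im : forall i, [set l i a | a : 'I_n.+1] = X i.

Local Notation J := (const_mx 1 : 'M[R]_n.+1).
Local Notation q := (n.+1%:R / n%:R : R).

Let lX i a : l i a \in X i.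
Proof. by rewrite -l_im imset_f. Qed.

Definition fiber_adj i j : 'M[R]_n.+1 :=
  \matrix_(a, b) (e (l i a) (l j b))%:R.
Local Notation A := fiber_adj.

Lemma fiber_adj_tr i j : (A i j)^T = A j i.
Proof. by apply/matrixP => a b; rewrite !mxE (lssd_sym lssd). Qed.

Lemma fiber_adj_mul i h j a b :
  (A i h *m A h j) a b
  = #|[set c in X h | e (l i a) c && e (l j b) c]|%:R.
Proof.
rewrite (card_imset_pred _ (@l_inj h) (l_im h)) -sum_nat_pred mxE.
apply: eq_bigr => c _.
by rewrite !mxE [e (l h c) _](lssd_sym lssd) -natrM mulnb.
Qed.

Lemma fiber_adj_gram i j : i != j ->
  A i j *m A j i = (k%:R - lam%:R) *: 1%:M + lam%:R *: J.
Proof.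
move=> ij; have [D De] := lssd_design lssd ij.
apply/matrixP => a b.
rewrite fiber_adj_mul (incidence_graph_common De) ?lX // (inj_eq (@l_inj i)).
by rewrite !mxE; case: eqP => _ /=; ring.
Qed.

Lemma fiber_adj_ones i j : i != j -> A i j *m J = k%:R *: J.
Proof.
move=> ij; have [D De] := lssd_design lssd ij.
apply/matrixP => a b; rewrite mulmx_ones !mxE mulr1.
have := incidence_graph_common De (lX i a) (lX i a); rewrite eqxx => <-.
rewrite (card_imset_pred _ (@l_inj j) (l_im j)) -sum_nat_pred.
by apply: eq_bigr => c _; rewrite !mxE andbb.
Qed.

Lemma fiber_adj_triple : exists mu nu : nat, forall h i j,
  h != i -> h != j -> i != j ->
  A i h *m A h j = (mu%:R - nu%:R) *: A i j + nu%:R *: J.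
Proof.
have [mu [nu linked]] := lssd_linked lssd.
exists mu, nu => h i j hi hj ij; apply/matrixP => a b.
rewrite fiber_adj_mul (linked _ _ _ hi hj ij) ?lX // !mxE.
by case: (e _ _) => /=; ring.
Qed.

Lemma ones_fiber_adj i j : i != j -> J *m A i j = k%:R *: J.
Proof.
move=> ij; rewrite -fiber_adj_tr; apply: ones_trmul.
by rewrite fiber_adj_ones 1?eq_sym.
Qed.

Let J_inj (x y : R) : x *: J = y *: J -> x = y.
Proof.
by move/matrixP/(_ ord0 ord0); rewrite !mxE !mulr1.
Qed.

(** Compute [A i j * A j i * J] in two ways. *)
Lemma lssd_design_identity (i j : 'I_w) : i != j ->
  k%:R ^+ 2 = k%:R + n%:R * lam%:R :> R.
Proof.
move=> ij; apply: J_inj.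
have ji : j != i by rewrite eq_sym.
transitivity (A i j *m (A j i *m J)).
  by rewrite fiber_adj_ones // -scalemxAr fiber_adj_ones // scalerA.
rewrite mulmxA fiber_adj_gram // mulmxDl -!scalemxAl mul1mx mul_ones_ones.
by rewrite scalerA -scalerDl -[n.+1%:R]natr1; congr (_ *: _); ring.
Qed.

(** By the previous identity, [n (k - lam) = k (v - k)]. *)
Lemma lssd_design_order_gt0 (i j : 'I_w) : i != j -> 0 < k%:R - lam%:R :> R.
Proof.
move=> ij; have [D _] := lssd_design lssd ij.
have n0 : (0 : R) < n%:R by rewrite ltr0n.
have k0 : (0 : R) < k%:R by rewrite ltr0n (sd_k_gt0 D).
have kn : k%:R < n%:R + 1 :> R by rewrite natr1 ltr_nat (sd_k_ltv D).
have E := lssd_design_identity ij.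
rewrite -(pmulr_rgt0 _ n0).
have -> : n%:R * (k%:R - lam%:R) = k%:R * (n%:R + 1 - k%:R) :> R.
  rewrite mulrBr; apply/eqP; rewrite -subr_eq0; apply/eqP.
  transitivity (k%:R ^+ 2 - (k%:R + n%:R * lam%:R) : R); first by ring.
  by rewrite E subrr.
by rewrite mulr_gt0 // subr_gt0.
Qed.

(** The first identity compares row sums.  For the second, expand
    [A i h * A h j * A j h * A h i], whose coefficient of [I] is
    [(k - lam) ^ 2] when the middle factors are multiplied first and
    [s ^ 2 (k - lam)] when the outer pairs are. *)
Lemma lssd_linked_identities (s nu : R) h i j :
    h != i -> h != j -> i != j -> A i h *m A h j = s *: A i j + nu *: J ->
  k%:R ^+ 2 = s * k%:R + nu * n.+1%:R /\ s ^+ 2 = k%:R - lam%:R.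
Proof.
move=> hi hj ij AA.
have [ih jh ji] : [/\ i != h, j != h & j != i] by split; rewrite eq_sym.
split.
  apply: J_inj; transitivity (A i h *m (A h j *m J)).
    by rewrite fiber_adj_ones // -scalemxAr fiber_adj_ones // scalerA.
  rewrite mulmxA AA mulmxDl -!scalemxAl mul_ones_ones fiber_adj_ones //.
  by rewrite !scalerA -scalerDl.
have AAt : A j h *m A h i = s *: A j i + nu *: J.
  rewrite -(fiber_adj_tr h j) -(fiber_adj_tr i h) -trmx_mul AA.
  by rewrite linearD !linearZ /= trmx_const fiber_adj_tr.
set m : R := k%:R - lam%:R.
have E1 : (A i h *m A h j) *m (A j h *m A h i) =
    (m * m) *: 1%:M + (m * lam%:R + lam%:R * k%:R ^+ 2) *: J.
  rewrite -mulmxA [A h j *m _]mulmxA fiber_adj_gram // mulmxDl mulmxDr.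
  rewrite -!scalemxAl -!scalemxAr mul1mx fiber_adj_gram //.
  rewrite ones_fiber_adj // -!scalemxAr fiber_adj_ones // !scalerDr !scalerA.
  by rewrite -addrA -scalerDl -/m; congr (_ + _ *: _); ring.
have := E1; rewrite AA AAt.
rewrite (mul_affine_ones _ _ _ _ (fiber_adj_ones ij) (ones_fiber_adj ji)).
rewrite fiber_adj_gram // scalerDr !scalerA -addrA -scalerDl.
move=> /(scalar_ones_inj n_gt0)[+ _]; rewrite -expr2.
by apply: mulIf; rewrite gt_eqF // (lssd_design_order_gt0 ij).
Qed.

Definition fiber_gram (c : R) i j : 'M[R]_n.+1 :=
  if i == j then simplex_gram R n
  else (c * n.+1%:R / n%:R) *: A i j + (- (c * k%:R / n%:R)) *: J.

Lemma fiber_gram_tr c i j : (fiber_gram c i j)^T = fiber_gram c j i.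
Proof.
rewrite /fiber_gram eq_sym; case: eqP => _; rewrite linearD !linearZ /=.
  by rewrite trmx1 trmx_const.
by rewrite trmx_const fiber_adj_tr.
Qed.

Lemma fiber_gram_ones c i j : fiber_gram c i j *m J = 0.
Proof.
rewrite /fiber_gram; case: eqVneq => [_|ij]; first exact: simplex_gram_ones.
rewrite mulmxDl -!scalemxAl fiber_adj_ones // mul_ones_ones !scalerA -scalerDl.
by rewrite -[RHS](scale0r J); congr (_ *: _); ring.
Qed.

(** With the design equations the products with [i = j] only determine [c] up
    to sign; the products over three distinct fibers fix this sign. *)
Lemma fiber_gram_mul : (1 < w)%N -> exists2 c : R, c != 0 &
  forall h i j, fiber_gram c i h *m fiber_gram c h j = q *: fiber_gram c i j.
Proof.
move=> w_gt1.
have [mu [nu AAA]] := fiber_adj_triple.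
pose o1 : 'I_w := Ordinal (ltnW w_gt1); pose o2 : 'I_w := Ordinal w_gt1.
have o12 : o1 != o2 by [].
set m : R := k%:R - lam%:R.
have m_gt0 : 0 < m by exact: lssd_design_order_gt0 o12.
have n_neq0 : n%:R != 0 :> R by rewrite pnatr_eq0 -lt0n.
have lamE : lam%:R = (k%:R ^+ 2 - k%:R) / n%:R :> R.
  by rewrite (lssd_design_identity o12); field.
pose s : R := mu%:R - nu%:R.
pose c : R := (-1) ^+ (s < 0)%R / Num.sqrt m.
have c2 : c ^+ 2 * m = 1.
  rewrite exprMn sqrr_sign mul1r exprVn sqr_sqrtr ?ltW // mulVf //.
  by rewrite gt_eqF.
have c_neq0 : c != 0.
  by apply: contra_eq_neq c2 => ->; rewrite expr0n mul0r eq_sym oner_eq0.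
exists c => // h i j.
have JG h' j' : J *m fiber_gram c h' j' = 0.
  rewrite -fiber_gram_tr -[J]trmx_const -trmx_mul fiber_gram_ones.
  by rewrite trmx0.
have [<-|hi] := eqVneq h i.
  rewrite {1}/fiber_gram eqxx simplex_gram_mulmx //.
have [<-|hj] := eqVneq h j.
  rewrite {2}/fiber_gram eqxx mulmx_simplex_gram // fiber_gram_ones //.
have ih : i != h by rewrite eq_sym.
rewrite /fiber_gram (negPf hj) (negPf ih).
rewrite (mul_affine_ones _ _ _ _ (fiber_adj_ones ih) (ones_fiber_adj hj)).
have [<-|ij] := eqVneq i j.
  rewrite fiber_adj_gram // !scalerDr !scalerA -addrA -scalerDl.
  congr (_ *: _ + _ *: _).
    transitivity (q * q * (c ^+ 2 * m)); last by rewrite c2 mulr1.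
    by rewrite /m; field.
  transitivity (q * - n%:R^-1 * (c ^+ 2 * m)); last by rewrite c2 mulr1.
  by rewrite /m lamE -[n.+1%:R]natr1; field.
have [kE s2] := lssd_linked_identities hi hj ij (AAA _ _ _ hi hj ij).
(* [c s = |s| / sqrt (k - lam)] by the choice of sign. *)
have cs : c * s = 1.
  rewrite mulrAC -normrEsign -/m in s2 *.
  rewrite -s2 sqrtr_sqr mulfV // normr_eq0 -sqrf_eq0 s2 gt_eqF //.
rewrite AAA // !scalerDr !scalerA -addrA -scalerDl -/s.
have s_neq0 : s != 0.
  by apply: contra_eq_neq cs => ->; rewrite mulr0 eq_sym oner_eq0.
have cE : c = s^-1 by rewrite -[RHS]mul1r -cs mulfK.
have v_neq0 : n%:R + 1 != 0 :> R by rewrite natr1 pnatr_eq0.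
have nuE : nu%:R = (k%:R ^+ 2 - s * k%:R) / (n%:R + 1) :> R.
  by rewrite kE -natr1 -/s; field.
congr (_ *: _ + _ *: _).
  rewrite cE; by field; apply/andP.
rewrite nuE cE -[n.+1%:R]natr1; field; exact/and3P.
Qed.

End FromLSSD.

(** * Linked simplices form a linked system of designs *)

Section FromSimplices.
Variables (R : realType) (n w : nat) (gamma zeta : R).
Variable S : 'I_w -> 'I_n.+1 -> 'rV[R]_n.
Hypotheses (n_gt0 : (0 < n)%N) (w_gt1 : (1 < w)%N) (zeta_lt : zeta < gamma).
Hypothesis linkedS : linked_simplices (v := n.+1) gamma zeta S.

Local Notation q := (n.+1%:R / n%:R : R).
Local Notation e := (simplex_graph (v := n.+1) gamma S).

Let M i : 'M[R]_(n.+1, n) := \matrix_a S i a.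

Let MMt i : M i *m (M i)^T = simplex_gram R n.
Proof. exact: regular_simplex_gram n_gt0 (linkedS.1 i). Qed.

Lemma sum_dotprod_simplex i h a : \sum_c dotprod (S i a) (S h c) = 0.
Proof.
have := ones_mulmx_simplex n_gt0 (MMt h).
move/(congr1 trmx); rewrite trmx_mul trmx_const trmx0.
move/(congr1 (mulmx (M i))); rewrite mulmxA mulmx0.
move/matrixP/(_ a ord0); rewrite mulmx_ones mxE => {2}<-.
by apply: eq_bigr => c _; rewrite dotprodE.
Qed.

(** The entries of [B i h * B h j = q * B i j], a consequence of
    [(M h)^T * M h = q I]. *)
Lemma parseval_simplex i j h a b :
  \sum_c dotprod (S i a) (S h c) * dotprod (S j b) (S h c)
  = q * dotprod (S i a) (S j b).
Proof.
transitivity ((M i *m (M h)^T *m (M h *m (M j)^T)) a b).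
  rewrite mxE; apply: eq_bigr => c _; rewrite -!dotprodE; congr (_ * _).
  by apply: eq_bigr => x _; rewrite mulrC.
rewrite mulmxA -(mulmxA (M i)) tight_frame_simplex // mul_mx_scalar.
by rewrite -scalemxAl mxE dotprodE.
Qed.

Lemma dotprod_linked i h a c : h != i ->
  dotprod (S i a) (S h c) = zeta + (gamma - zeta) * (e (i, a) (h, c))%:R.
Proof.
rewrite eq_sym => ih; rewrite /simplex_graph /= ih /=.
have [->|->] := linkedS.2 i h a c ih.
  by rewrite eqxx /=; ring.
by rewrite lt_eqF // /=; ring.
Qed.

(** The entry of
    [A i h * A h j = (B i h - zeta J) (B h j - zeta J) / (gamma - zeta) ^ 2]
    at a place where [B i j] has the entry [t]. *)
Definition common_count (t : R) : R :=
  (q * t + zeta ^+ 2 * n.+1%:R) / (gamma - zeta) ^+ 2.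

(** Truncation turns [common_count] into a function with natural values, so that
    [k], [lam], [mu] and [nu] can be named before any count is exhibited; with
    only two fibers, no count would provide [mu] and [nu]. *)
Lemma card_common h i j a b : h != i -> h != j ->
  #|[set c | e (i, a) (h, c) && e (j, b) (h, c)]|
  = Num.truncn (common_count (dotprod (S i a) (S j b))).
Proof.
move=> hi hj; apply: (can_inj (g := @Num.truncn R) (f := fun k => k%:R)).
  by move=> k; rewrite natrK.
suff E : #|[set c | e (i, a) (h, c) && e (j, b) (h, c)]|%:R
         = common_count (dotprod (S i a) (S j b)).
  by rewrite -E natrK.
have d_neq0 : gamma - zeta != 0 by rewrite subr_eq0 gt_eqF.
have adjE k d c : h != k -> (e (k, d) (h, c))%:R
    = (dotprod (S k d) (S h c) - zeta) / (gamma - zeta).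
  by move=> hk; rewrite (dotprod_linked _ _ hk) addrC addKr mulrC mulKf.
rewrite -sum_nat_pred.
transitivity ((\sum_c (dotprod (S i a) (S h c) * dotprod (S j b) (S h c)
   - zeta * dotprod (S i a) (S h c) - zeta * dotprod (S j b) (S h c)
   + zeta ^+ 2)) / (gamma - zeta) ^+ 2).
  rewrite mulr_suml; apply: eq_bigr => c _.
  by rewrite -mulnb natrM !adjE //; field.
rewrite !big_split /= !sumrN -!mulr_sumr !sum_dotprod_simplex mulr0 oppr0.
rewrite !addr0 parseval_simplex sumr_const card_ord /common_count -mulr_natr.
by congr (_ / _); ring.
Qed.

(** This is what makes [0 < k < v]: since the inner products with a simplex sum
    to zero, a constant value would be zero, against [parseval_simplex] for a
    unit vector. *)
Lemma not_const_dotprod i h a t : ~ forall c, dotprod (S i a) (S h c) = t.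
Proof.
move=> St.
have t0 : t = 0.
  have /eqP := sum_dotprod_simplex i h a.
  under eq_bigr do rewrite St.
  by rewrite sumr_const card_ord -mulr_natr mulf_eq0 pnatr_eq0 orbF => /eqP.
have := parseval_simplex i i h a a.
rewrite big1 => [|c _]; last by rewrite St t0 mulr0.
rewrite (rs_unit (linkedS.1 i)) mulr1 => /esym/eqP.
by rewrite mulf_eq0 invr_eq0 !pnatr_eq0 /=; apply/negP; rewrite -lt0n.
Qed.

Lemma simplex_graph_sym : symmetric e.
Proof.
move=> x y; rewrite /simplex_graph eq_sym; congr (_ && (_ == _)).
by apply: eq_bigr => c _; rewrite mulrC.
Qed.

Lemma simplex_graph_LSSD : exists k lam : nat,
  is_LSSD n.+1 k lam e (@simplex_fiber n.+1 w).
Proof.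
pose kk t := Num.truncn (common_count t).
exists (kk 1), (kk (-1 / n%:R)).
have deg (i h : 'I_w) a : h != i -> #|[set c | e (i, a) (h, c)]| = kk 1.
  move=> hi; have := card_common a a hi hi.
  rewrite (rs_unit (linkedS.1 i)) -/(kk 1) => <-.
  by apply: eq_card => c; rewrite !inE andbb.
have deg2 (i h : 'I_w) (a b : 'I_n.+1) : h != i -> a != b ->
    #|[set c | e (i, a) (h, c) && e (i, b) (h, c)]| = kk (-1 / n%:R).
  by move=> hi ab; rewrite (card_common _ _ hi hi) (rs_dot (linkedS.1 i) ab).
have k_gt0 (i h : 'I_w) (a : 'I_n.+1) : h != i -> (0 < kk 1%R)%N.
  move=> hi; rewrite -(deg i h a hi) lt0n; apply/negP => /eqP/cards0_eq E.
  apply: (@not_const_dotprod i h a zeta) => c.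
  have := in_set0 c; rewrite -E inE dotprod_linked // => ->.
  by rewrite mulr0 addr0.
have k_ltv (i h : 'I_w) (a : 'I_n.+1) : h != i -> (kk 1%R < n.+1)%N.
  move=> hi; rewrite -(deg i h a hi) -[X in (_ < X)%N](card_ord n.+1).
  rewrite -cardsT proper_card // properT; apply/eqP => E.
  apply: (@not_const_dotprod i h a gamma) => c.
  have := in_setT c; rewrite -E inE dotprod_linked // => ->.
  by rewrite mulr1 addrC subrK.
have fiber_im (h : 'I_w) : [set (h, c) | c : 'I_n.+1] = simplex_fiber n.+1 h.
  apply/setP => -[h' c]; rewrite inE /=; apply/imsetP/eqP => [[c' _ []//]|->].
  by exists c.
split=> //.
- exact: simplex_graph_sym.
- by move=> x; rewrite /simplex_graph eqxx.
- by rewrite card_prod !card_ord.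
- by apply/setP => x; rewrite in_setT; apply/bigcupP; exists x.1; rewrite ?inE.
- move=> i j ij; rewrite disjoint_subset; apply/subsetP => x.
  by rewrite !inE => /eqP ->.
- by move=> i; rewrite -fiber_im card_imset ?card_ord // => c c' [].
- by move=> i x y; rewrite !inE /simplex_graph => /eqP -> /eqP ->; rewrite eqxx.
- move=> i j ij; have ji : j != i by rewrite eq_sym.
  have esym := simplex_graph_sym.
  unshelve eexists (@SymmetricDesign n.+1 (kk 1) (kk (-1 / n%:R))
    'I_n.+1 'I_n.+1 (fun a b => e (i, a) (j, b)) _ _ _ _ _ _ _ _).
  + exact: k_gt0 i j ord0 ji.
  + exact: k_ltv i j ord0 ji.
  + exact: card_ord.
  + exact: card_ord.
  + move=> b; rewrite -(deg j i b ij); apply: eq_card => a.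
    by rewrite !inE esym.
  + by move=> a; apply: deg.
  + by move=> a b ab; apply: deg2.
  + move=> a b ab; rewrite -(deg2 j i a b ij ab); apply: eq_card => c.
    by rewrite !inE ![e (i, c) _]esym.
  exists (fun s => match s with inl a => (i, a) | inr b => (j, b) end).
  split=> [||| [a|b] [a'|b']] /=.
  + by move=> [a|a] [b|b] [] // => [->|E|E|->] //; rewrite E eqxx in ij.
  + exact: fiber_im.
  + exact: fiber_im.
  + by rewrite /edges_between !inE /= eqxx (negPf ij) !andbF.
  + by rewrite /edges_between !inE /= !eqxx /= andbT.
  + by rewrite /edges_between !inE /= !eqxx /= orbT andbT esym.
  + by rewrite /edges_between !inE /= eqxx (negPf ji) !andbF.
- exists (kk gamma), (kk zeta) => h i j hi hj ij [i' a] [j' b].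
  rewrite !inE /= => /eqP -> /eqP ->.
  rewrite (card_imset_pred (f := pair h) _ _ (fiber_im h)); last first.
    by move=> c d [].
  rewrite card_common // dotprod_linked 1?eq_sym //.
  by case: (e _ _); rewrite ?mulr1 ?mulr0 ?addr0 // addrC subrK.
Qed.

End FromSimplices.

(** * The equivalence *)

Theorem theorem4p5 (R : realType) (v w : nat)
    (hv : (2 <= v)%N) (hw : (2 <= w)%N) :
  (forall (k lam : nat) (V : finType) (e : rel V) (X : 'I_w -> {set V}),
     is_LSSD v k lam e X ->
     exists (gamma zeta : R) (S : 'I_w -> 'I_v -> 'rV[R]_(v.-1))
            (l : 'I_w -> 'I_v -> V),
       [/\ gamma != zeta,
           linked_simplices gamma zeta S,
           forall i, injective (l i) /\ [set l i a | a : 'I_v] = X i &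
           forall i j a b, i != j ->
             dotprod (S i a) (S j b) =
             if e (l i a) (l j b) then gamma else zeta])
  /\
  (forall (gamma zeta : R) (S : 'I_w -> 'I_v -> 'rV[R]_(v.-1)),
     zeta < gamma ->
     linked_simplices gamma zeta S ->
     exists k lam : nat,
       is_LSSD v k lam (simplex_graph gamma S) (@simplex_fiber v w)).
Proof.
case: v hv => [//|n]; rewrite ltnS => n_gt0.
split=> [k lam V e X lssd|gamma zeta S zg linkedS]; last first.
  exact: simplex_graph_LSSD n_gt0 hw zg linkedS.
pose l i (a : 'I_n.+1) : V :=
  enum_val (cast_ord (esym (lssd_fiber_size lssd i)) a).
have l_inj i : injective (l i).
  by move=> a b /enum_val_inj/cast_ord_inj.
have l_im i : [set l i a | a : 'I_n.+1] = X i.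
  apply/setP => x; apply/imsetP/idP => [[a _ ->]|xX]; first exact: enum_valP.
  exists (cast_ord (lssd_fiber_size lssd i) (enum_rank_in xX x)) => //.
  by rewrite /l cast_ordK enum_rankK_in.
have [c c_neq0 BB] := fiber_gram_mul R n_gt0 lssd l_inj l_im hw.
have n_neq0 : n%:R != 0 :> R by rewrite pnatr_eq0 -lt0n.
have [||||S [regS dotS]] :=
    @gram_realization R n _ (fiber_gram k e l c) (Ordinal (ltnW hw)) n_gt0.
- by move=> i; rewrite /fiber_gram eqxx.
- by move=> i j; rewrite (fiber_gram_tr _ lssd).
- by move=> i j; rewrite (fiber_gram_ones n_gt0 lssd).
- by move=> i j; apply: BB.
pose zeta := - (c * k%:R / n%:R).
pose gamma := c * n.+1%:R / n%:R + zeta.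
have dotE i j a b : i != j ->
    dotprod (S i a) (S j b) = if e (l i a) (l j b) then gamma else zeta.
  move=> ij; rewrite dotS /fiber_gram (negPf ij) !mxE mulr1.
  by case: (e _ _); rewrite ?mulr1 ?mulr0 ?add0r.
exists gamma, zeta, S, l; split=> //.
  by rewrite -subr_eq0 addrK !mulf_neq0 ?invr_eq0 // pnatr_eq0.
split=> [//|i j a b ij].
by rewrite dotE //; case: ifP; [left|right].
Qed.
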